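(* Any representation of $64$ that steps up upon first arriving at the carry value $9$ is a local representation. (This holds for all such representations, both decomposable and indecomposable.)
   Context: $\mathcal P$ denotes the set of Newman polynomials, i.e. polynomials with all coefficients in $\{0,1\}$ and constant term $1$ (including the constant polynomial $1$). A representation of an integer $m\equiv 1\pmod 3$ is an expression $m=\frac{p(3)}{q(3)}$ with $p(x),q(x)\in\mathcal P$. It is universal if $q(x)\mid p(x)$ (as polynomials), and local if $q(x)\nmid p(x)$. Carry values: let $m>1$, $m\equiv 1 \pmod 3$, and let $m=\frac{p(3)}{q(3)}$ be a representation with $p(x)=\sum_i \epsilon_i x^i$, $q(x)=\sum_i \delta_i x^i$, $\epsilon_i,\delta_i\in\{0,1\}$. The multiplication $m\cdot q(3)=p(3)$ is carried out digit by digit in base $3$: set $c_0=0$ and $c_{i+1}=\frac{c_i+m\delta_i-\epsilon_i}{3}$; these are non-negative integers, called carry values, and $c_{\deg p+1}=0$. The representation thus corresponds to the closed walk $c_0\to c_1\to\cdots\to c_{\deg p+1}$ from $0$ to $0$. If $c_i\equiv 1\pmod 3$ then necessarily $(\delta_i,\epsilon_i)=(0,1)$; if $c_i\equiv 2 \pmod 3$ then $(\delta_i,\epsilon_i)=(1,0)$; if $c_i\equiv 0\pmod 3$ then either $(\delta_i,\epsilon_i)=(1,1)$, called a step up from $c_i$, or $(\delta_i,\epsilon_i)=(0,0)$, called a step down from $c_i$. A representation of $64$ ''steps up upon first arriving at the carry value $9$'' if, for the smallest index $i$ with $c_i=9$, one has $(\delta_i,\epsilon_i)=(1,1)$ (so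 that the next carry value is $c_{i+1}=24$). A representation is indecomposable if $c_i\neq 0$ for all $0<i\le \deg p$ (the walk does not visit $0$ except at its endpoints), and decomposable otherwise. *)

(* Defs.v *)
From HB Require Import structures.
From mathcomp Require Import all_boot all_order all_algebra.

Set Implicit Arguments.
Unset Strict Implicit.
Unset Printing Implicit Defensive.

Import Order.TTheory GRing.Theory Num.Theory.
Local Open Scope ring_scope.

Definition newman (p : {poly int}) : Prop :=
  (forall i : nat, p`_i = 0 \/ p`_i = 1) /\ p`_0 = 1.

Definition representation (m : int) (p q : {poly int}) : Prop :=
  [/\ (m = 1 %[mod 3])%Z, newman p, newman q &
      m%:~R = (p.[3])%:~R / (q.[3])%:~R :> rat].

(* On {poly int} the relation %| is pseudo-divisibility; a Newman divisor is
   monic, so here it is genuine divisibility in Z[x], see newman_dvdpP. *)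
Definition universal_representation (m : int) (p q : {poly int}) : Prop :=
  representation m p q /\ q %| p.

Definition local_representation (m : int) (p q : {poly int}) : Prop :=
  representation m p q /\ ~~ (q %| p).

Lemma newman_monic (q : {poly int}) : newman q -> q \is monic.
Proof.
move=> [q01 q0]; have nz : q != 0.
  by apply/eqP => qE; move: q0; rewrite qE coef0.
rewrite monicE; case: (q01 (size q).-1) => qn; last exact/eqP.
by move: nz; rewrite -lead_coef_eq0 lead_coefE qn eqxx.
Qed.

Lemma newman_dvdpP (p q : {poly int}) : newman q ->
  reflect (exists r : {poly int}, p = r * q) (q %| p).
Proof.
move=> /newman_monic mq; apply: (iffP (Pdiv.IdomainMonic.dvdpP mq p)).
  by case=> r ->; exists r.
by case=> r ->; exists r.
Qed.

(* The carries are computed in rat so that the division by 3 is exact; the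
   coefficients of p are the epsilon_i and those of q the delta_i. *)
Fixpoint carry (m : int) (p q : {poly int}) (i : nat) : rat :=
  if i is j.+1 then
    (carry m p q j + m%:~R * (q`_j)%:~R - (p`_j)%:~R) / 3
  else 0.

Definition steps_up_at (p q : {poly int}) (i : nat) : Prop :=
  q`_i = 1 /\ p`_i = 1.

Definition steps_up_upon_first_arriving (m : int) (p q : {poly int})
    (c : rat) : Prop :=
  exists i : nat,
    [/\ carry m p q i = c,
        forall j : nat, (j < i)%N -> carry m p q j <> c
      & steps_up_at p q i].

(* Main.v *)
(* If [p = r q], comparing the sizes of [p(3)] and [q(3)] forces [deg r = 4],
   and [r] is monic.  The carry walk must begin 0 -> 21 -> 28 -> 9, since the
   step down from 21 leads into the cycle 7 -> 2 -> 22 -> 7, which misses 9.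
   Hence stepping up at 9 gives [q = 1 + x + x^3 + ...] and
   [p = 1 + x + x^2 + x^3 + ...], so that [r = x^4 - x^3 + x^2 + 1].  The
   coefficient of [x^5] in [r q] is then [2 + q_5], which is not 0 or 1. *)
Require Import Defs.
From mathcomp Require Import all_boot all_order all_algebra.
From mathcomp Require Import zify ring.

Import Order.TTheory GRing.Theory Num.Theory.
Local Open Scope ring_scope.

(** The extreme case has all digits 1, where the geometric sum is [(3 ^+ n - 1) / 2]; hence the
    factor 2. *)
Lemma newman_partial_sum_bounds (p : {poly int}) n : newman p ->
  0 <= 2 * \sum_(i < n) p`_i * 3 ^+ i < 3 ^+ n.
Proof.
move=> np; elim: n => [|n /andP[IH0 IH1]]; first by rewrite big_ord0.
rewrite big_ord_recr /= exprS.
have : 0 < 3 ^+ n :> int by rewrite exprn_gt0.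
move: (\sum_(i < n) _) (3 ^+ n) IH0 IH1 => s e IH0 IH1 e0.
by have [-> | ->] := proj1 np n; lia.
Qed.

Lemma newman_horner3_lt (p : {poly int}) : newman p ->
  2 * p.[3] < 3 ^+ size p.
Proof.
move=> np; rewrite horner_coef.
by have /andP[] := newman_partial_sum_bounds p (size p) np.
Qed.

Lemma newman_horner3_ge (p : {poly int}) : newman p ->
  3 ^+ size p <= 3 * p.[3].
Proof.
move=> np; have mp := newman_monic np.
have : (0 < size p)%N by rewrite size_poly_gt0 monic_neq0.
move/monicP: mp; rewrite lead_coefE horner_coef.
case: (size p) => [//|n] /= pn _.
rewrite big_ord_recr /= pn exprS mul1r ler_pM2l // lerDr.
by have /andP[] := newman_partial_sum_bounds p n np; rewrite pmulr_rge0.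
Qed.

Lemma newman_horner3_gt0 (p : {poly int}) : newman p -> 0 < p.[3].
Proof.
move=> np; have := newman_horner3_ge p np.
have : 0 < 3 ^+ size p :> int by rewrite exprn_gt0.
lia.
Qed.

Lemma representation_horner3 m p q : representation m p q ->
  p.[3] = m * q.[3].
Proof.
case=> _ _ nq mE; apply: (@intr_inj rat); rewrite intrM mE divfK //.
by rewrite intr_eq0 gt_eqF ?newman_horner3_gt0.
Qed.

(** With [d] the difference of the sizes, the bounds on both values put the quotient strictly
    between [2/3 * 3^d] and [3/2 * 3^d]. Only [d = 4] admits 64, as 54 < 64 < 121.5. *)
Lemma representation64_size p q : representation 64 p q ->
  size p = (size q + 4)%N.
Proof.
move=> rep; have pq := representation_horner3 _ _ _ rep.
case: rep => _ np nq _.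
have := newman_horner3_ge p np; have := newman_horner3_lt p np.
have := newman_horner3_ge q nq; have := newman_horner3_lt q nq.
rewrite pq => qlt qge plt pge.
have pow_lt (a b : nat) : 3 ^+ a < 3 ^+ b :> int -> (a < b)%N.
  by rewrite ltr_eXn2l.
have h1 : (size p < size q + 5)%N by apply: pow_lt; rewrite exprD; lia.
have h2 : (size q + 3 < size p)%N by apply: pow_lt; rewrite exprD; lia.
lia.
Qed.

Lemma carry_partial_sum m p q n :
  carry m p q n * 3 ^+ n = (\sum_(i < n) (m * q`_i - p`_i) * 3 ^+ i)%:~R.
Proof.
elim: n => [|n IH]; first by rewrite big_ord0 mul0r.
rewrite big_ord_recr /= intrD -IH exprS !(intrM, intrB) rmorphXn /=.
by field.
Qed.

(** Past both sizes the partial sum is all of [m * q.[3] - p.[3]], which vanishes. *)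
Lemma carry_eventually0 m p q n : representation m p q ->
  (size p <= n)%N -> (size q <= n)%N -> carry m p q n = 0.
Proof.
move=> /representation_horner3 pq pn qn.
have : carry m p q n * 3 ^+ n = 0.
  rewrite carry_partial_sum; apply/eqP; rewrite intr_eq0; apply/eqP.
  under eq_bigr do rewrite mulrBl -mulrA.
  rewrite sumrB -mulr_sumr -(horner_coef_wide _ pn) -(horner_coef_wide _ qn).
  by rewrite pq subrr.
by move/eqP; rewrite mulf_eq0 expf_eq0 andbF orbF => /eqP.
Qed.

(* Integrality propagates backwards from the final carry 0. *)
Lemma carry_int m p q n : representation m p q ->
  exists z : int, carry m p q n = z%:~R.
Proof.
move=> rep; have : (size p + size q <= n + (size p + size q))%N by lia.
(* Only the second occurrence is generalized, so [k] bounds the distance from [n] to the range where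
   carries vanish. *)
elim: {2}(size p + size q)%N n => [|k IH] n le_n.
  by exists 0; apply: carry_eventually0 => //; lia.
have [|z zE] := IH n.+1; first lia.
exists (3 * z - m * q`_n + p`_n).
by rewrite intrD intrB !intrM -zE /=; field.
Qed.

Lemma carry_step m p q n (z : int) : representation m p q ->
  carry m p q n = z%:~R ->
  exists2 z' : int, carry m p q n.+1 = z'%:~R & 3 * z' = z + m * q`_n - p`_n.
Proof.
move=> rep zE; have [z' z'E] := carry_int m p q n.+1 rep.
exists z' => //; apply: (@intr_inj rat).
by rewrite intrB intrD !intrM -zE -z'E /=; field.
Qed.

(** None of 7, 2, 22 is divisible by 3, so every digit is forced and the walk is trapped in this
    cycle, although it must end at 0. *)
Lemma carry64_not7 p q n : representation 64 p q -> carry 64 p q n <> 7.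
Proof.
move=> rep c7; have [_ np nq _] := rep.
have cyc k : exists2 z : int, carry 64 p q (n + k) = z%:~R &
    [\/ z = 7, z = 2 | z = 22].
  elim: k => [|k [z zE zcyc]]; first by rewrite addn0; exists 7; last exact: Or31.
  rewrite addnS; have [z' z'E step] := carry_step _ _ _ _ _ rep zE.
  exists z' => //.
  have pnk := proj1 np (n + k)%N; have qnk := proj1 nq (n + k)%N.
  by case: zcyc => ?; [apply: Or32|apply: Or33|apply: Or31]; lia.
have [z] := cyc (size p + size q)%N.
rewrite carry_eventually0 //; try lia.
by move/esym/eqP; rewrite intr_eq0 => /eqP ->; case.
Qed.

Lemma steps_up64_coefs p q : representation 64 p q ->
  steps_up_upon_first_arriving 64 p q 9 ->
  [/\ q`_1 = 1, q`_2 = 0, q`_3 = 1 &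
      [/\ p`_1 = 1, p`_2 = 1 & p`_3 = 1]].
Proof.
move=> rep [i [ci first_i [qi pi]]].
have [_ [p01 p0] [q01 q0] _] := rep.
have c0 : carry 64 p q 0 = 0%:~R by [].
have [z1 c1 step1] := carry_step _ _ _ _ _ rep c0.
have [z2 c2 step2] := carry_step _ _ _ _ _ rep c1.
have [z3 c3 step3] := carry_step _ _ _ _ _ rep c2.
have z2_neq7 : z2 <> 7.
  by move=> z2E; apply: (carry64_not7 p q 2 rep); rewrite c2 z2E.
(* Constant terms 1 give 63/3 = 21; from there the choice is 7, now excluded, or (21 + 63)/3 =
   28. *)
have [q1 p1 z1E z2E] : [/\ q`_1 = 1, p`_1 = 1, z1 = 21 & z2 = 28].
  by have qi1 := q01 1%N; have pi1 := p01 1%N; split; lia.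
have [q2 p2 z3E] : [/\ q`_2 = 0, p`_2 = 1 & z3 = 9].
  by have qi2 := q01 2%N; have pi2 := p01 2%N; split; lia.
have c3E : carry 64 p q 3 = 9 by rewrite c3 z3E.
(* The carry 9 occurs at index 3, and the earlier carries 0, 21, 28 differ from it, so the first
   arrival is there. *)
have i_le3 : (i <= 3)%N.
  by rewrite leqNgt; apply/negP => i_gt3; exact: (first_i 3%N i_gt3 c3E).
have i3 : i = 3%N.
  case: i ci i_le3 {first_i qi pi} => [|[|[|[|//]]]] ci _; last by [].
  - by move/eqP: ci; rewrite c0 (eqr_int _ 0 9).
  - by move/eqP: ci; rewrite c1 z1E (eqr_int _ 21 9).
  - by move/eqP: ci; rewrite c2 z2E (eqr_int _ 28 9).
move: qi pi; rewrite {}i3 {ci first_i i_le3} => q3 p3.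
split; [exact: q1|exact: q2|exact: q3|split; [exact: p1|exact: p2|exact: p3]].
Qed.

Lemma cofactor64_size p q r : representation 64 p q -> p = r * q ->
  size r = 5%N /\ r \is monic.
Proof.
move=> rep pE; have sz := representation64_size p q rep.
have [_ /newman_monic mp /newman_monic mq _] := rep.
have mr : r \is monic by move: mp; rewrite pE monicMr.
split=> //; move: sz; rewrite pE size_Mmonic ?monic_neq0 //.
have : (0 < size q)%N by rewrite size_poly_gt0 monic_neq0.
lia.
Qed.

Theorem theorem3p3 (p q : {poly int}) :
  representation 64 p q ->
  steps_up_upon_first_arriving 64 p q 9 ->
  local_representation 64 p q.
Proof.
move=> rep up; split=> //; have [_ [p01 p0] nq _] := rep.
apply/negP => /(newman_dvdpP _ nq) [r pE].
have [r_size /monicP] := cofactor64_size p q r rep pE.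
rewrite lead_coefE r_size /= => r4.
have r5 : r`_5 = 0 by rewrite nth_default ?r_size.
have [q1 q2 q3 [p1 p2 p3]] := steps_up64_coefs p q rep up.
have [q01 q0] := nq.
have conv n : p`_n = \sum_(j < n.+1) r`_j * q`_(n - j) by rewrite pE coefM.
have := conv 0%N; have := conv 1%N; have := conv 2%N; have := conv 3%N.
(* Coefficient 4 is skipped: it only says that [p] and [q] agree there. In coefficient 5 the unknown
   [q]_4[is multiplied by]r[_1 = 0]. *)
have := conv 5%N; have := p01 5%N; have := q01 5%N.
rewrite !big_ord_recr !big_ord0 /= !subn0.
rewrite p0 p1 p2 p3 q0 q1 q2 q3 r4 r5 => h5 h5' e5 e3 e2 e1 e0.
have r0 : r`_0 = 1 by rewrite e0 add0r mulr1.
have r1 : r`_1 = 0 by rewrite r0 in e1; lia.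
have r2 : r`_2 = 1 by rewrite r0 r1 in e2; lia.
have r3 : r`_3 = -1 by rewrite r0 r1 r2 in e3; lia.
rewrite r0 r1 r2 r3 in e5; lia.
Qed.
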